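(* Let $X$ be a complete metric space and let $w_1,\ldots,w_N\in\mathcal M(X)$ be such that the corresponding attractor $A$ is uncountable and every set $w_i(A)\cap w_j(A)$, $i\neq j$, is at most countable. Then the system $(w_1,\ldots,w_N)$ satisfies the strong Markov property (SMP).
   Context: $\mathbb N=\{1,2,\ldots\}$, $N\in\mathbb N$, and $d$ is the distance in $X$. A mapping $w:X\to X$ is contracting if $\sigma(w)=\sup_{x\neq y\in X}\frac{d(w(x),w(y))}{d(x,y)}<1$. $\mathcal M(X)$ denotes the set of all contracting homeomorphisms of $X$ onto itself. For $(w_1,\ldots,w_N)\in(\mathcal M(X))^N$, the attractor $A=A(w_1,\ldots,w_N)$ is the unique non-empty compact subset of $X$ with $A=\bigcup_{i=1}^N w_i(A)$. Let $\Sigma=\{1,\ldots,N\}$, and for $\mathbf i=(i_1,\ldots,i_n)\in\Sigma^n$ let $w_{\mathbf i}=w_{i_1}\circ\cdots\circ w_{i_n}$. The system satisfies the strong Markov property (SMP) if for every $n\in\mathbb N$ there is an open set $\mathcal O_n\subset X$ such that (1) $\overline{\mathcal O_n\cap A}=A$; and (2) $w_{\mathbf i}(\mathcal O_n)\cap w_{\mathbf j}(\mathcal O_n)=\emptyset$ for all $\mathbf i\neq\mathbf j\in\Sigma^n$. *)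

(* Defs.v *)
From HB Require Import structures.
From mathcomp Require Import all_boot all_order all_algebra.
From mathcomp Require Import all_classical all_reals all_analysis.

Set Implicit Arguments.
Unset Strict Implicit.
Unset Printing Implicit Defensive.

Import Order.TTheory GRing.Theory Num.Theory.

Local Open Scope classical_set_scope.
Local Open Scope ring_scope.

(* [Complete] carries a base point: this only leaves out the empty space,
   which has no non-empty subset and hence no attractor. *)
#[short(type="completeMetricType")]
HB.structure Definition CompleteMetric (R : realType) :=
  {T of Complete T & Metric R T}.

Definition homeomorphism (S T : topologicalType) (f : S -> T) : Prop :=
  exists g : T -> S, [/\ cancel f g, cancel g f, continuous f & continuous g].

(* The supremum is taken in the extended reals, so that an unbounded set of
   quotients gives +oo. On a one-point space it is -oo. *)
Definition lip_sup (R : realType) (X : metricType R) (f : X -> X) : \bar R :=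
  ereal_sup [set (mdist (f p.1) (f p.2) / mdist p.1 p.2)%:E
            | p in [set p : X * X | p.1 != p.2]].

Definition contracting (R : realType) (X : metricType R) (f : X -> X) : Prop :=
  (lip_sup f < 1)%E.

Definition contracting_homeo (R : realType) (X : metricType R) :
    set (X -> X) :=
  [set f | contracting f /\ homeomorphism f].

(* On a complete metric space, finitely many (at least one) contractions have
   exactly one attractor, so a statement quantified over all [A] such that
   [is_attractor w A] is a statement about that set. *)
Definition is_attractor (X : topologicalType) (N : nat) (w : 'I_N -> X -> X)
    (A : set X) : Prop :=
  [/\ A !=set0, compact A & A = \bigcup_(i in [set: 'I_N]) (w i @` A)].

(* [word_map w [:: i1; ...; in]] is [w i1 \o ... \o w in]. *)
Definition word_map (X : Type) (N : nat) (w : 'I_N -> X -> X)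
    (s : seq 'I_N) : X -> X :=
  foldr (fun i f => w i \o f) id s.

Definition strong_Markov_property (X : topologicalType) (N : nat)
    (w : 'I_N -> X -> X) (A : set X) : Prop :=
  forall n : nat, (0 < n)%N ->
  exists O : set X,
    [/\ open O,
        closure (O `&` A) = A
      & forall i j : n.-tuple 'I_N, i != j ->
          (word_map w i @` O) `&` (word_map w j @` O) = set0].

(* Main.v *)
Require Import Defs.
From HB Require Import structures.
From mathcomp Require Import all_boot all_order all_algebra.
From mathcomp Require Import all_classical all_reals all_analysis.

Import Order.TTheory GRing.Theory Num.Theory.
Import numFieldNormedType.Exports.
Local Open Scope classical_set_scope.
Local Open Scope ring_scope.

(** Write [w_s] for [word_map w s].  For a given length [n], take for [O] the
    set of all points [x] such that, for all distinct words [i], [j] of length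
    [n], the image [w_i x] is strictly closer to the compact set [w_i A] than
    to [w_j A].

    - The images of [O] under [w_i] and [w_j] are disjoint: a common point
      would be strictly closer to [w_i A] than to [w_j A], and conversely.
    - [O] is open, as a finite intersection of preimages of open sets, because
      the distance to a set is continuous ([open_edist_inf_lt]).
    - [O] contains all but countably many points of [A].  A point [x] of [A]
      outside [O] has, for some [i != j], an image [w_i x] at distance [0] from
      both [w_i A] and [w_j A], hence in their intersection.  Intersections of
      distinct cylinders of the same length are countable
      ([word_overlap_countable]): where the two words first differ, they are
      images of subsets of some [w_a A `&` w_b A] with [a != b].  Since the maps
      are injective, only countably many [x] are lost.
    - Every neighbourhood of a point of [A] meets [A] in an uncountable set
      ([attractor_nbhs_uncountable]), because it contains a small cylinder
      [w_s A], a bijective copy of [A].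

    By the last two points, [O `&` A] is dense in [A]. *)

Set Implicit Arguments.
Unset Strict Implicit.

(** * Distance to a set *)

Lemma ereal_between (R : realFieldType) (a b : \bar R) :
  (a < b)%E -> exists r : R, (a < r%:E < b)%E.
Proof.
case: a b => [a| |] [b| |] //; rewrite ?lte_fin => ab.
- by exists ((a + b) / 2); rewrite !lte_fin !midf_lt.
- by exists (a + 1); rewrite ltry lte_fin ltrDl ltr01.
- by exists (b - 1); rewrite ltNyr lte_fin ltrBlDr ltrDl ltr01.
- by exists 0; rewrite ltry ltNyr.
Qed.

Lemma open_edist_inf_lt (R : realType) (X : pseudoMetricType R)
    (A B : set X) :
  open [set x | (edist_inf A x < edist_inf B x)%E].
Proof.
rewrite openE => x /= /ereal_between [r /andP[Ar rB]].
rewrite /interior; near=> y => /=.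
apply: (@lt_trans _ _ r%:E).
  near: y; exact: (edist_inf_continuous (open_ereal_lt' Ar)).
near: y; exact: (edist_inf_continuous (open_ereal_gt' rB)).
Unshelve. all: by end_near. Qed.

Lemma edist_inf_gt0 (R : realType) (X : pseudoMetricType R) (B : set X)
    (x : X) :
  closed B -> ~ B x -> (0 < edist_inf B x)%E.
Proof.
move=> cB nBx; have /nbhs_ballP [e /= e0 eB] : nbhs x (~` B).
  by apply: open_nbhs_nbhs; split=> //; exact: closed_openC.
apply: (@lt_le_trans _ _ e%:E); first by rewrite lte_fin.
apply: le_ereal_inf_tmp => _ [b Bb <-]; rewrite leNgt; apply/negP.
by move=> /edist_lt_ball /eB.
Qed.

Lemma compact_mdist_bounded (R : realType) (X : metricType R) (A : set X) :
  compact A -> exists D : R, forall a b, A a -> A b -> mdist a b <= D.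
Proof.
move=> cA; have [->|/set0P [p Ap]] := eqVneq A set0; first by exists 0.
have cp : {within A, continuous (mdist p : X -> R)}.
  apply: continuous_subspaceT => x; apply/cvgrPdist_lt => e e0.
  apply/nbhs_ballP; exists e => //= y; rewrite ballEmdist /= => xye.
  apply: le_lt_trans xye.
  rewrite ler_distl lerBlDr metric_triangle /=.
  by rewrite [mdist x y]metric_sym metric_triangle.
have /compact_bounded [M [_ hM]] := continuous_compact cp cA.
(* [bounded_set] only gives a bound by each number strictly above [M]. *)
exists ((M + 1) + (M + 1)) => a b Aa Ab.
apply: (le_trans (metric_triangle a p b)).
have h x : A x -> mdist p x <= M + 1.
  move=> Ax; apply: le_trans (ler_norm _) _.
  by apply: (hM (M + 1)); [rewrite ltrDl|exists x].
by rewrite metric_sym lerD ?h.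
Qed.

(** * Contraction ratios *)

(** The ratio is truncated below at [0] because [lip_sup] is [-oo] on a
    one-point space. *)
Lemma contracting_mdist (R : realType) (X : metricType R) (f : X -> X) :
  contracting f ->
  exists2 c : R, 0 <= c < 1 & forall x y, mdist (f x) (f y) <= c * mdist x y.
Proof.
rewrite /contracting => hf.
have [c c01 fc] : exists2 c : R, 0 <= c < 1 & (lip_sup f <= c%:E)%E.
  case: (lip_sup f) hf => [r| |] // hr.
    exists (Num.max 0 r); first by rewrite le_max lexx gt_max ltr01.
    by rewrite lee_fin le_max lexx orbT.
  by exists 0; rewrite ?lexx ?ltr01 ?leNye.
exists c => // x y; have [->|xy] := eqVneq x y; first by rewrite !mdistxx mulr0.
have : ((mdist (f x) (f y) / mdist x y)%:E <= c%:E)%E.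
  by apply: le_trans fc; apply: ereal_sup_ubound; exists (x, y).
by rewrite lee_fin ler_pdivrMr // mdist_gt0.
Qed.

Lemma uniform_ratio (R : realType) (X : metricType R) (N : nat)
    (w : 'I_N -> X -> X) :
  (forall i, contracting (w i)) -> exists2 c : R, 0 <= c < 1 &
    forall i x y, mdist (w i x) (w i y) <= c * mdist x y.
Proof.
move=> hw; have /choice [c hc] : forall i, exists c : R,
    0 <= c < 1 /\ forall x y, mdist (w i x) (w i y) <= c * mdist x y.
  by move=> i; have [c] := contracting_mdist (hw i); exists c.
exists (\big[Num.max/0]_i c i).
  rewrite bigmax_ge_id /=; apply/bigmax_ltP; split=> [|i _]; first exact: ltr01.
  by case: (hc i) => /andP[].
move=> i x y; apply: le_trans (proj2 (hc i) x y) _.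
by rewrite ler_wpM2r ?mdist_ge0 // le_bigmax.
Qed.

Lemma word_map_mdist (R : realType) (X : metricType R) (N : nat)
    (w : 'I_N -> X -> X) (c : R) (s : seq 'I_N) x y :
  0 <= c -> (forall i x y, mdist (w i x) (w i y) <= c * mdist x y) ->
  mdist (word_map w s x) (word_map w s y) <= c ^+ size s * mdist x y.
Proof.
move=> c0 hc; elim: s => [|i s IH] /=; first by rewrite expr0 mul1r.
by rewrite exprS -mulrA; apply: le_trans (hc _ _ _) _; rewrite ler_wpM2l.
Qed.

(** * Cylinders of a self-similar set *)

Lemma word_map_inj (X : Type) (N : nat) (w : 'I_N -> X -> X) (s : seq 'I_N) :
  (forall i, injective (w i)) -> injective (word_map w s).
Proof. by move=> hw; elim: s => [|i s IH] //= x y /hw /IH. Qed.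

Lemma word_map_continuous (X : topologicalType) (N : nat)
    (w : 'I_N -> X -> X) (s : seq 'I_N) :
  (forall i, continuous (w i)) -> continuous (word_map w s).
Proof.
move=> hw; elim: s => [|i s IH] /= x; first exact: cvg_id.
by apply: continuous_comp; [exact: IH|exact: hw].
Qed.

Lemma word_map_sub (X : Type) (N : nat) (w : 'I_N -> X -> X) (A : set X)
    (s : seq 'I_N) :
  A = \bigcup_(i in [set: 'I_N]) (w i @` A) -> word_map w s @` A `<=` A.
Proof.
move=> hA; elim: s => [|i s IH] _ [a Aa <-] //=.
rewrite hA; exists i => //; exists (word_map w s a) => //.
by apply: IH; exists a.
Qed.

Lemma word_map_cover (X : Type) (N : nat) (w : 'I_N -> X -> X) (A : set X)
    (m : nat) (x : X) :
  A = \bigcup_(i in [set: 'I_N]) (w i @` A) -> A x ->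
  exists2 s : seq 'I_N, size s = m & (word_map w s @` A) x.
Proof.
move=> hA; elim: m x => [|m IH] x Ax; first by exists [::] => //; exists x.
move: Ax; rewrite {1}hA => -[i _ [y /IH [s sm [a Aa <-]] <-]].
by exists (i :: s); [rewrite /= sm|exists a].
Qed.

(** A common first letter can be cancelled, by injectivity, and distinct first
    letters [i], [j] put the intersection inside [w i @` A `&` w j @` A]. *)
Lemma word_overlap_countable (X : Type) (N : nat) (w : 'I_N -> X -> X)
    (A : set X) (s t : seq 'I_N) :
  A = \bigcup_(i in [set: 'I_N]) (w i @` A) ->
  (forall i, injective (w i)) ->
  (forall i j, i != j -> countable ((w i @` A) `&` (w j @` A))) ->
  size s = size t -> s != t ->
  countable ((word_map w s @` A) `&` (word_map w t @` A)).
Proof.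
move=> hA winj hcap; elim: s t => [|i s IH] [|j t] //= [st].
have [<-|ij] := eqVneq i j => nst.
  apply: (@sub_countable _ _ _
    (w i @` ((word_map w s @` A) `&` (word_map w t @` A)))).
    apply: subset_card_le => _ [[a Aa <-] [b Ab] /winj ba].
    by exists (word_map w s a) => //; split; [exists a|exists b].
  apply: sub_countable (card_image_le _ _) _; apply: IH => //.
  by move: nst; rewrite eqseq_cons eqxx.
apply: sub_countable (hcap _ _ ij); apply: subset_card_le.
move=> x [[a Aa <-] [b Ab /= ba]]; split.
  by exists (word_map w s a) => //; apply: (word_map_sub hA); exists a.
by exists (word_map w t b) => //; apply: (word_map_sub hA); exists b.
Qed.

(** The cylinders of length [m] cover [A] and have diameter at most [c ^+ m]
    times that of [A], so one of them lies in [V] for large [m]; it has the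
    same cardinality as [A]. *)
Lemma attractor_nbhs_uncountable (R : realType) (X : metricType R) (N : nat)
    (w : 'I_N -> X -> X) (A : set X) :
  (forall i, contracting (w i)) -> (forall i, injective (w i)) ->
  is_attractor w A -> ~ countable A ->
  forall (x : X) (V : set X), A x -> nbhs x V -> ~ countable (V `&` A).
Proof.
move=> hw winj [_ cA hA] hunc x V Ax /nbhs_ballP [e /= e0 eV] cVA.
have [c /andP[c0 c1] hc] := uniform_ratio hw.
have [D hD] := compact_mdist_bounded cA.
have D0 : 0 <= D by apply: le_trans (hD x x Ax Ax); exact: mdist_ge0.
have [m hm] : exists m, c ^+ m * D < e.
  have h : c ^+ m * D @[m --> \oo] --> 0.
    rewrite -[X in _ --> X](mul0r D); apply: cvgMl; apply: cvg_expr.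
    by rewrite ger0_norm.
  have /cvgrPdist_lt /(_ e e0) [m _ /(_ m (leqnn m)) /=] := h.
  by rewrite sub0r normrN ger0_norm ?mulr_ge0 ?exprn_ge0 //; exists m.
have [s sm [a Aa sx]] := word_map_cover m hA Ax.
apply: hunc.
have /eq_countable <- : (word_map w s @` A #= A)%card.
  by apply: inj_card_eq => y z _ _; exact: word_map_inj.
apply: sub_countable cVA; apply: subset_card_le => _ [b Ab <-]; split.
  apply: eV; rewrite ballEmdist /= -sx; apply: le_lt_trans hm.
  rewrite -sm; apply: le_trans (word_map_mdist _ _ _ c0 hc) _.
  by rewrite ler_wpM2l ?exprn_ge0 // hD.
by apply: (@word_map_sub _ _ _ _ s hA); exists b.
Qed.

Unset Implicit Arguments.

(** * The strong Markov property *)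

Theorem proposition3 (R : realType) (X : completeMetricType R) (N : nat)
  (hN : (0 < N)%N) (w : 'I_N -> X -> X)
  (hw : forall i : 'I_N, contracting_homeo (w i))
  (A : set X) (hA : is_attractor w A)
  (hunc : ~ countable A)
  (hcap : forall i j : 'I_N, i != j -> countable ((w i @` A) `&` (w j @` A))) :
  strong_Markov_property w A.
Proof.
move=> n n0; have [_ cA eA] := hA.
have wcontr i : contracting (w i) := proj1 (hw i).
have winj i : injective (w i).
  by have [_ [g [gK _ _ _]]] := hw i; exact: can_inj gK.
have wcont i : continuous (w i) by have [_ [g []]] := hw i.
have closedA : closed A by apply: compact_closed cA; exact: metric_hausdorff.
have closedW (s : seq 'I_N) : closed (word_map w s @` A).
  apply: compact_closed; first exact: metric_hausdorff.
  apply: continuous_compact cA; apply: continuous_subspaceT.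
  exact: word_map_continuous.
pose W (i : n.-tuple 'I_N) := word_map w i @` A.
pose U (p : n.-tuple 'I_N * n.-tuple 'I_N) : set X :=
  word_map w p.1 @^-1` [set y | (edist_inf (W p.1) y < edist_inf (W p.2) y)%E].
pose O := \bigcap_(p in [set p | p.1 != p.2]) U p.
have overlap p x : A x -> ~ U p x -> W p.2 (word_map w p.1 x).
  move=> Ax nU; apply: contrapT => nW; apply: nU; rewrite /U /=.
  by rewrite edist_inf0; [apply: edist_inf_gt0 => //; exact: closedW|exists x].
exists O; split.
- rewrite openE => x Ox; rewrite /interior; near=> y => p pne.
  (* There are finitely many pairs of words, so one neighbourhood of [x] serves
     all of them. *)
  move: p pne; near: y; apply: filter_forall => p.
  have [pne|pe] := boolP (p.1 != p.2); last first.
    by apply: nearW => y /=; rewrite (negbTE pe).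
  near=> y => _; near: y; apply: word_map_continuous => //.
  by apply: open_nbhs_nbhs; split; [exact: open_edist_inf_lt|exact: Ox].
- apply/seteqP; split.
    rewrite [X in _ `<=` X](proj1 (closure_id A) closedA).
    by apply: closureS => y [].
  move=> x Ax V Vx; apply: contrapT => VOA.
  (* If [V] missed [O `&` A], all of [V `&` A] would lie in the countable set of
     points lost to overlaps. *)
  apply: (attractor_nbhs_uncountable wcontr winj hA hunc Ax Vx).
  apply: (@sub_countable _ _ _
    (\bigcup_(p in [set p : n.-tuple 'I_N * n.-tuple 'I_N | p.1 != p.2])
       (word_map w p.1 @^-1` (W p.1 `&` W p.2)))).
    apply: subset_card_le => y [Vy Ay]; apply: contrapT => nP; apply: VOA.
    exists y; split=> //; split=> // p pne; apply: contrapT => nU; apply: nP.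
    by exists p => //; split; [exists y|exact: overlap].
  apply: bigcup_countable => [|[i j] /= ij]; first exact: countableP.
  apply: (@sub_countable _ _ _ (W i `&` W j)).
    by apply: card_ge_preimage => y z _ _; exact: word_map_inj.
  by apply: word_overlap_countable; rewrite ?size_tuple.
- move=> i j ij; apply/seteqP; split => // _ [[x Ox <-] [y Oy yx]].
  have := Ox (i, j) ij; have := Oy (j, i).
  rewrite /U /= yx eq_sym => /(_ ij) h1 h2.
  by have := lt_trans h1 h2; rewrite ltxx.
Unshelve. all: by end_near. Qed.
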